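(* Let $\mathcal{B}\subset\mathcal{A}=\mathcal{U}_q(\widehat{\mathfrak{gl}}(1|1))$ be the quantum affine (left) coideal subalgebra defined by the root space involution $\Theta(\alpha_0)=-\alpha_0-2\alpha_1$, $\Theta(\alpha_1)=\alpha_1$, generated by the Cartan generators $k_i^{\pm1}$ ($i=0,1,2$), the Chevalley generators $\xi_1^\pm$ and the twisted affine generator $$B_0^-=\xi_0^--d_-\,[h_2^+,\xi_1'^{+}],\qquad \xi_1'^{+}=k_1^{-1}\xi_1^+.$$ If $d_-=(q^{-1}-q)/2$, then $\mathcal{B}$ is a reflection algebra for a vector boundary. That is, the intertwining equation $$(T_{1/z}\otimes T_s)[\Delta(b)]\,K(z)=K(z)\,(T_z\otimes T_s)[\Delta(b)]\qquad\text{for all }b\in\mathcal{B}$$ defines a $K$-matrix $K(z)\in\mathrm{End}(\mathcal V\otimes\mathcal W)$ satisfying the reflection equation $$R_{12}(z/w)\,K_{13}(z)\,R_{12}(zw)\,K_{23}(w)=K_{23}(w)\,R_{12}(zw)\,K_{13}(z)\,R_{12}(z/w)$$ on $\mathcal{V}\otimes\mathcal{V}\otimes\mathcal{W}$.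
   Context: $q\in\mathbb{C}^\times$ is transcendental. $\mathcal{U}_q(\widehat{\mathfrak{gl}}(1|1))$ is the quantum affine superalgebra (Drinfeld–Jimbo realization) generated by fermionic (odd) elements $\xi_0^\pm,\xi_1^\pm$ and Cartan generators $k_0,k_1,k_2$ ($k_2=q^{h_2}$, with $h_2$ the non-supertraceless generator completing $\mathfrak{sl}(1|1)$ to $\mathfrak{gl}(1|1)$), with relations $k_ik_j=k_jk_i$, $k_i\xi_j^\pm k_i^{-1}=q^{\pm\hat a_{ij}}\xi_j^\pm$, $\{\xi_i^+,\xi_j^-\}=\delta_{ij}\frac{k_i-k_i^{-1}}{q-q^{-1}}$ (there are no Chevalley generators with index 2) and the standard Serre relations of this algebra, where $$(\hat a_{ij})_{0\le i,j\le2}=\begin{pmatrix}0&0&-2\\0&0&2\\-2&2&0\end{pmatrix}.$$ Its simple roots are the two fermionic roots $\alpha_0,\alpha_1$. The level-one Drinfeld generator $h_2^+$ has coproduct $\Delta(h_2^+)=h_2^+\otimes1+1\otimes h_2^++2\,\xi_0^+k_1\otimes\xi_1^+$; the other coproducts are $\Delta(k_i)=k_i\otimes k_i$, $\Delta(\xi_i^+)=\xi_i^+\otimes1+k_i\otimes\xi_i^+$, $\Delta(\xi_i^-)=\xi_i^-\otimes k_i^{-1}+1\otimes\xi_i^-$. Tensor products are graded. A subalgebra $\mathcal B$ is a left coideal subalgebra if $\Delta(b)\in\mathcal A\otimes\mathcal B$ for all $b\in\mathcal B$. Fundamental evaluation representation on the graded two-dimensional space $\mathcal V$ with basis $v_1$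 (even), $v_2$ (odd) and matrix units $e_{i,j}$: $T_z(\xi_1^+)=e_{1,2}$, $T_z(\xi_1^-)=e_{2,1}$, $T_z(\xi_0^+)=z\,e_{2,1}$, $T_z(\xi_0^-)=-z^{-1}e_{1,2}$, $T_z(k_1)=q(e_{1,1}+e_{2,2})$, $T_z(k_0)=q^{-1}(e_{1,1}+e_{2,2})$, $T_z(k_2)=q\,e_{1,1}+q^{-1}e_{2,2}$, $T_z(h_2)=e_{1,1}-e_{2,2}$, $T_z(h_2^+)=\frac{z\,q}{q^{-1}-q}(e_{1,1}-e_{2,2})$. The boundary space $\mathcal W$ is equivalent to $\mathcal V$, and the boundary representation $T_s$ on it is obtained by replacing $z$ with the boundary spectral parameter $s$. The $R$-matrix on $\mathcal V\otimes\mathcal V$ in the basis $v_1\otimes v_1,v_1\otimes v_2,v_2\otimes v_1,v_2\otimes v_2$ is $$R(z)=\begin{pmatrix}1&0&0&0\\0&r&1-q\,r&0\\0&1-r/q&r&0\\0&0&0&-1+(q+1/q)\,r\end{pmatrix},\qquad r=\frac{z-1}{q\,z-1/q}.$$ Subscripts on $R$ and $K$ indicate the tensor factors acted on.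
   Formalization: The reflection equation as printed fails for generic z, w; it is stated with R_21 in place of R_12(z/w) on the left and of R_12(zw) on the right, where R has no pole; K(z) is unique up to scalar except where z²=1 and s=zq^{±2}. *)

(* Defs.v *)
From HB Require Import structures.
From mathcomp Require Import all_boot all_order all_algebra.
From mathcomp Require Import reals.
From mathcomp Require Import complex mxtens.

Set Implicit Arguments.
Unset Strict Implicit.
Unset Printing Implicit Defensive.

Import GRing.Theory.
Local Open Scope ring_scope.

(* In characteristic 0, a Z/2-grading of an algebra is the same thing as an   *)
(* involutive automorphism: homogeneous elements of parity p are those a      *)
(* with parity a = (-1)^p a.                                                  *)
Record superalgebra (C : numFieldType) := SuperAlgebra {
  sa_alg :> algType C;
  parity : {lrmorphism sa_alg -> sa_alg};
  parityK : involutive parity }.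

Definition homogeneous (C : numFieldType) (A : superalgebra C) (p : bool)
  (a : A) : Prop := parity A a = (-1) ^+ p *: a.

Definition bilinear_map (C : numFieldType) (U V M : lmodType C)
    (f : U -> V -> M) : Prop :=
  (forall v, linear (f^~ v)) /\ (forall u, linear (f u)).

(* The graded tensor product of superalgebras, given by the universal         *)
(* property of the underlying vector space (lift and uniqueness) and the      *)
(* multiplication with the Koszul sign.                                       *)
Record graded_tensor (C : numFieldType) (A B : superalgebra C) :=
  GradedTensor {
  gt_alg :> algType C;
  tens : A -> B -> gt_alg;
  tens_bilinear : bilinear_map tens;
  tens_lift : forall (M : lmodType C) (f : A -> B -> M),
    bilinear_map f -> {linear gt_alg -> M};
  tens_liftE : forall (M : lmodType C) (f : A -> B -> M)
    (fP : bilinear_map f) (a : A) (b : B), tens_lift fP (tens a b) = f a b;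
  tens_ext : forall (M : lmodType C) (g h : {linear gt_alg -> M}),
    (forall a b, g (tens a b) = h (tens a b)) -> g =1 h;
  tens1 : tens 1 1 = 1;
  tensM : forall (p p' : bool) (a : A) (b : B) (a' : A) (b' : B),
    homogeneous p b -> homogeneous p' a' ->
    tens a b * tens a' b' = (-1) ^+ (p && p') *: tens (a * a') (b * b') }.

Section QuantumAffineGl11.
Variable C : numFieldType.
Implicit Types (q z : C).

Definition ahat : 'M[int]_3 :=
  \matrix_(i < 3, j < 3)
    nth 0 (nth [::] [:: [::  0; 0; -2];
                        [::  0; 0;  2];
                        [:: -2; 2;  0]] i) j.

(* the Chevalley index j = 0, 1 as a Cartan index *)
Definition cidx (j : 'I_2) : 'I_3 := widen_ord (isT : 2 <= 3)%N j.

Definition i0 : 'I_2 := ord0.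
Definition i1 : 'I_2 := ord_max.

(* A superalgebra with Chevalley elements xip, xim, invertible Cartan         *)
(* elements k, and the level-one Drinfeld element h2p, subject to the         *)
(* relations and the coproduct of U_q(gl^(1|1)). Odd elements have the        *)
(* anticommutator as graded commutator. As the roots alpha_0, alpha_1 are     *)
(* isotropic and mutually orthogonal, the Serre relations reduce to           *)
(* (xi_i)^2 = 0: the centrality of {xi_0, xi_1} in the subalgebra generated   *)
(* by xi_0 and xi_1 follows from it. Further relations, such as the Drinfeld  *)
(* relations of h2p, may or may not hold in uq_alg.                           *)
Record Uq_affine_gl11 q := UqAffineGl11 {
  uq_alg :> superalgebra C;
  xip : 'I_2 -> uq_alg;
  xim : 'I_2 -> uq_alg;
  k : 'I_3 -> uq_alg;
  kV : 'I_3 -> uq_alg;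
  h2p : uq_alg;
  xip_odd : forall j, homogeneous true (xip j);
  xim_odd : forall j, homogeneous true (xim j);
  k_even : forall i, homogeneous false (k i);
  h2p_even : homogeneous false h2p;
  kkV : forall i, k i * kV i = 1;
  kVk : forall i, kV i * k i = 1;
  k_comm : forall i j, k i * k j = k j * k i;
  k_xip : forall i j, k i * xip j * kV i = q ^ ahat i (cidx j) *: xip j;
  k_xim : forall i j, k i * xim j * kV i = q ^ (- ahat i (cidx j)) *: xim j;
  xip_xim : forall i j, xip i * xim j + xim j * xip i =
    (i == j)%:R *: ((q - q^-1)^-1 *: (k (cidx i) - kV (cidx i)));
  xip_sq : forall j, xip j * xip j = 0;
  xim_sq : forall j, xim j * xim j = 0;
  k_h2p : forall i, k i * h2p = h2p * k i;
  uq_tens : graded_tensor uq_alg uq_alg;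
  Delta : {lrmorphism uq_alg -> uq_tens};
  Delta_k : forall i, Delta (k i) = tens uq_tens (k i) (k i);
  Delta_xip : forall j, Delta (xip j) =
    tens uq_tens (xip j) 1 + tens uq_tens (k (cidx j)) (xip j);
  Delta_xim : forall j, Delta (xim j) =
    tens uq_tens (xim j) (kV (cidx j)) + tens uq_tens 1 (xim j);
  Delta_h2p : Delta h2p =
    tens uq_tens h2p 1 + tens uq_tens 1 h2p
    + 2%:R *: tens uq_tens (xip i0 * k (cidx i1)) (xip i1) }.

(* Operators act on column vectors; v_1 (even), v_2 (odd) are the basis       *)
(* vectors of index 0, 1.                                                     *)
Definition e (i j : 'I_2) : 'M[C]_2 := delta_mx i j.

Definition sgnV : 'M[C]_2 := e i0 i0 - e i1 i1.

Definition evaluation_representation q (A : Uq_affine_gl11 q) z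
    (T : {lrmorphism A -> 'M[C]_2}) : Prop :=
  [/\ forall a, T (parity A a) = sgnV *m T a *m sgnV,
      [/\ T (xip A i1) = e i0 i1, T (xim A i1) = e i1 i0,
          T (xip A i0) = z *: e i1 i0 & T (xim A i0) = - z^-1 *: e i0 i1],
      [/\ T (k A (cidx i1)) = q *: (e i0 i0 + e i1 i1),
          T (k A (cidx i0)) = q^-1 *: (e i0 i0 + e i1 i1) &
          T (k A ord_max) = q *: e i0 i0 + q^-1 *: e i1 i1] &
      T (h2p A) = (z * q / (q^-1 - q)) *: (e i0 i0 - e i1 i1)].

(* Koszul rule (X (x) Y)(v (x) w) = (-1)^{|Y||v|} X v (x) Y w, with Y split   *)
(* into its even and odd parts; the ordinary Kronecker product *t orders the  *)
(* basis as v1(x)v1, v1(x)v2, v2(x)v1, v2(x)v2.                               *)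
Definition gkron (X Y : 'M[C]_2) : 'M[C]_(2 * 2) :=
  X *t (2%:R^-1 *: (Y + sgnV *m Y *m sgnV))
  + (X *m sgnV) *t (2%:R^-1 *: (Y - sgnV *m Y *m sgnV)).

Lemma gkron_bilinear (A : algType C) (T T' : {lrmorphism A -> 'M[C]_2}) :
  bilinear_map (fun a b => gkron (T a) (T' b)).
Proof.
have tl m n p r (c : C) (X X' : 'M[C]_(m, n)) (Y : 'M[C]_(p, r)) :
    (c *: X + X') *t Y = c *: (X *t Y) + X' *t Y.
  by apply/matrixP=> i j; rewrite !mxE mulrDl mulrA.
have tr m n p r (c : C) (X : 'M[C]_(m, n)) (Y Y' : 'M[C]_(p, r)) :
    X *t (c *: Y + Y') = c *: (X *t Y) + X *t Y'.
  by apply/matrixP=> i j; rewrite !mxE mulrDr mulrCA.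
split=> [b|a] c u v /=; rewrite /gkron linearP; move: sgnV => S.
  by rewrite mulmxDl -scalemxAl !tl -addrACA -scalerDr.
rewrite mulmxDr mulmxDl -scalemxAr -scalemxAl.
set x := T' u; set x' := S *m x *m S.
set y := T' v; set y' := S *m y *m S.
have -> : c *: x + y + (c *: x' + y') = c *: (x + x') + (y + y').
  by rewrite scalerDr addrACA.
have -> : c *: x + y - (c *: x' + y') = c *: (x - x') + (y - y').
  by rewrite scalerBr opprD addrACA.
have sc (Z Z' : 'M[C]_2) : 2%:R^-1 *: (c *: Z + Z')
    = c *: (2%:R^-1 *: Z) + 2%:R^-1 *: Z'.
  by rewrite scalerDr !scalerA mulrC.
by rewrite !sc !tr -addrACA -scalerDr.
Qed.

(* T (x) T' on the graded tensor square *)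
Definition rep_tens q (A : Uq_affine_gl11 q) (T T' : {lrmorphism A -> 'M[C]_2})
  : {linear uq_tens A -> 'M[C]_(2 * 2)} :=
  tens_lift (uq_tens A) (gkron_bilinear T T').

Inductive subalgebra_gen (A : algType C) (X : A -> Prop) : A -> Prop :=
| sg_gen a : X a -> subalgebra_gen X a
| sg_one : subalgebra_gen X 1
| sg_lin c a b : subalgebra_gen X a -> subalgebra_gen X b ->
    subalgebra_gen X (c *: a + b)
| sg_mul a b : subalgebra_gen X a -> subalgebra_gen X b ->
    subalgebra_gen X (a * b).

(* Delta(B) is contained in A (x) B *)
Definition left_coideal q (A : Uq_affine_gl11 q) (B : A -> Prop) : Prop :=
  forall b, B b -> exists (n : nat) (x y : 'I_n -> A),
    (forall i, B (y i)) /\ Delta A b = \sum_(i < n) tens (uq_tens A) (x i) (y i).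

Definition xip' q (A : Uq_affine_gl11 q) : A := kV A (cidx i1) * xip A i1.

(* h2p is even, so the graded commutator is the ordinary one *)
Definition B0m q (A : Uq_affine_gl11 q) (d : C) : A :=
  xim A i0 - d *: (h2p A * xip' A - xip' A * h2p A).

Inductive coideal_gens q (A : Uq_affine_gl11 q) (d : C) : A -> Prop :=
| cg_k i : coideal_gens d (k A i)
| cg_kV i : coideal_gens d (kV A i)
| cg_xip : coideal_gens d (xip A i1)
| cg_xim : coideal_gens d (xim A i1)
| cg_B0m : coideal_gens d (B0m A d).

Definition coideal_subalgebra q (A : Uq_affine_gl11 q) (d : C) : A -> Prop :=
  subalgebra_gen (@coideal_gens q A d).

Definition intertwines q (A : Uq_affine_gl11 q) (B : A -> Prop)
    (T : C -> {lrmorphism A -> 'M[C]_2}) (s z : C) (K : 'M[C]_(2 * 2)) : Prop :=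
  forall b, B b ->
    rep_tens (T z^-1) (T s) (Delta A b) *m K
    = K *m rep_tens (T z) (T s) (Delta A b).

Definition rR q z : C := (z - 1) / (q * z - q^-1).

(* R(z) is defined when this denominator does not vanish. *)
Definition R_regular q z : Prop := q * z - q^-1 != 0.

Definition Rmx q z : 'M[C]_(2 * 2) :=
  let r := rR q z in
  \matrix_(i < 2 * 2, j < 2 * 2)
    nth 0 (nth [::] [:: [:: 1; 0;         0;         0];
                        [:: 0; r;         1 - q * r; 0];
                        [:: 0; 1 - r / q; r;         0];
                        [:: 0; 0;         0;         - 1 + (q + q^-1) * r]] i) j.

(* graded flip v (x) w |-> (-1)^{|v||w|} w (x) v *)
Definition Pmx : 'M[C]_(2 * 2) :=
  \matrix_(i < 2 * 2, j < 2 * 2)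
    nth 0 (nth [::] [:: [:: 1; 0; 0;   0];
                        [:: 0; 0; 1;   0];
                        [:: 0; 1; 0;   0];
                        [:: 0; 0; 0; - 1]] i) j.

(* Embeddings into End(V (x) V (x) W). All operators embedded below are even  *)
(* (an intertwiner K commutes with the action of k_2), so no signs arise      *)
(* except from the graded flips.                                              *)
Definition on12 (X : 'M[C]_(2 * 2)) : 'M[C]_(2 * 2 * 2) := X *t (1%:M : 'M[C]_2).
Definition on23 (X : 'M[C]_(2 * 2)) : 'M[C]_(2 * 2 * 2) := (1%:M : 'M[C]_2) *t X.
Definition on21 (X : 'M[C]_(2 * 2)) := on12 Pmx *m on12 X *m on12 Pmx.
Definition on13 (X : 'M[C]_(2 * 2)) := on23 Pmx *m on12 X *m on23 Pmx.

(* Operators compose from right to left, and R Delta = Delta^op R. On the     *)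
(* left-hand side, R_12(zw), applied to the ordered pair (1,2), turns the     *)
(* coproduct into its opposite, so that after K_13(z) the auxiliary spaces    *)
(* are met in the order (2,1). Hence the R-matrix applied second on each side *)
(* is the one of the ordered pair (2,1), i.e. the conjugate by the graded     *)
(* flip; R(z) is not invariant under this conjugation.                        *)
Definition reflection_equation q (K : C -> 'M[C]_(2 * 2)) (z w : C) : Prop :=
  on21 (Rmx q (z / w)) *m on13 (K z) *m on12 (Rmx q (z * w)) *m on23 (K w)
  = on23 (K w) *m on21 (Rmx q (z * w)) *m on13 (K z) *m on12 (Rmx q (z / w)).

End QuantumAffineGl11.

(* Main.v *)
(* The vector generators [k_i], [xi_1^+], [xi_1^-] do not see the spectral
   parameter, so an intertwiner lies in the commutant of U_q(gl(1|1)) on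
   V (x) W, which is two-dimensional: it has the form [x + b N] for a fixed
   rank-two matrix [N]. The twisted affine generator [B0m] fixes the ratio
     x : b = (q^2 z - s) (q^2 s z - 1) : (1 - q^2) (1 - z^2) s,
   and the reflection equation becomes a polynomial identity in [q, s, z, w]
   once the denominators of [R] are cleared. That it is enough to check the
   intertwining equation on generators follows from the multiplicativity of
   the graded tensor product of two representations. *)
Require Import Defs.
From HB Require Import structures.
From mathcomp Require Import all_boot all_order all_algebra.
From mathcomp Require Import reals.
From mathcomp Require Import complex mxtens ring.
Set Implicit Arguments.
Unset Strict Implicit.
Unset Printing Implicit Defensive.
Import GRing.Theory.
Local Open Scope ring_scope.
Local Open Scope complex_scope.

(** * Sparse matrices with symbolically computed products *)

Section SparseMatrices.
Variable C : comNzRingType.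
Implicit Types (x y : option C) (l : seq (seq (option C))).

(* [None] stands for a structural zero, so that products of sparse matrices can
   be normalized by computation although equality in [C] does not compute. *)
Definition oadd x y :=
  if x is Some a then (if y is Some b then Some (a + b) else x) else y.

Definition omul x y :=
  if x is Some a then (if y is Some b then Some (a * b) else None) else None.

Definition omx n l : 'M[C]_n :=
  \matrix_(i, j) odflt 0 (nth None (nth [::] l i) j).

(** An entry all of whose summands are structural zeros stays [None], so sparsity survives long
    products. *)
Definition omulmx n l l' :=
  mkseq (fun i => mkseq (fun j => foldr oadd None
    (mkseq (fun m => omul (nth None (nth [::] l i) m)
                          (nth None (nth [::] l' m) j)) n)) n) n.

Lemma odflt_add x y : odflt 0 (oadd x y) = odflt 0 x + odflt 0 y.
Proof. by case: x y => [a|] [b|] //=; rewrite ?add0r ?addr0. Qed.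

Lemma odflt_mul x y : odflt 0 (omul x y) = odflt 0 x * odflt 0 y.
Proof. by case: x y => [a|] [b|] //=; rewrite ?mul0r ?mulr0. Qed.

Lemma omxM n l l' : omx n l *m omx n l' = omx n (omulmx n l l').
Proof.
apply/matrixP=> i j; rewrite !mxE !nth_mkseq //.
pose F m := omul (nth None (nth [::] l i) m) (nth None (nth [::] l' m) j).
rewrite (eq_bigr (fun m : 'I_n => odflt 0 (F m))); last first.
  by move=> m _; rewrite !mxE odflt_mul.
rewrite -(big_mkord xpredT (fun m => odflt 0 (F m))) /index_iota subn0 /mkseq.
rewrite -/F; elim: (iota 0 n) => [|m r IHr]; first by rewrite big_nil.
by rewrite big_cons IHr /= odflt_add.
Qed.

Lemma omx_eq n l l' : omx n l = omx n l' ->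
  forall i j, (i < n)%N -> (j < n)%N ->
  odflt 0 (nth None (nth [::] l i) j) = odflt 0 (nth None (nth [::] l' i) j).
Proof.
by move=> ll' i j ltin ltjn; have /matrixP/(_ (Ordinal ltin) (Ordinal ltjn)) :=
  ll'; rewrite !mxE.
Qed.

(** The six-vertex shape common to the flip, the R-matrix and the K-matrix: weight is preserved, so
    only the two middle basis vectors mix. *)
Definition sixv (a b c d e f : option C) :=
  [:: [:: a; None; None; None]; [:: None; b; c; None];
      [:: None; d; e; None]; [:: None; None; None; f]].

End SparseMatrices.

Lemma eq_cons T (x y : T) s t : x = y -> s = t -> x :: s = y :: t.
Proof. by move=> -> ->. Qed.

Ltac ord_cases i := case: i => i; do 8?[case: i => [|i]]; move=> // ?.

(** Only list and index operations are unfolded; the ring operations of [C] stay intact for [ring]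
    and [field]. *)
Ltac omx_lazy := lazy beta iota zeta delta
    [muln addn Nat.mul Nat.add muln_rec addn_rec omulmx mkseq map iota foldr
     nth omul oadd odflt oapp].

Ltac omx_compute := rewrite !omxM; omx_lazy.

(** Structural zeros must agree on both sides and close by reflexivity; one scalar identity is left
    for each other entry. *)
Ltac omx_entries := lazymatch goal with
  | |- omx _ _ = omx _ _ => apply: f_equal; omx_entries
  | |- (_ :: _) = (_ :: _) => apply: eq_cons; omx_entries
  | |- Some _ = Some _ => apply: f_equal
  | |- _ => reflexivity
  end.

(** * The reflection equation as a polynomial identity *)

Section ReflectionEquation.
Variable C : numFieldType.

Lemma on12_sixv (a b c d e f : option C) : on12 (omx 4 (sixv a b c d e f)) =
  omx 8 (let n := None in
    [:: [:: a; n; n; n; n; n; n; n]; [:: n; a; n; n; n; n; n; n];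
        [:: n; n; b; n; c; n; n; n]; [:: n; n; n; b; n; c; n; n];
        [:: n; n; d; n; e; n; n; n]; [:: n; n; n; d; n; e; n; n];
        [:: n; n; n; n; n; n; f; n]; [:: n; n; n; n; n; n; n; f]]).
Proof.
apply/matrixP=> i j; rewrite !mxE.
ord_cases i; ord_cases j; by rewrite /= ?(mulr1, mulr0).
Qed.

Lemma on23_sixv (a b c d e f : option C) : on23 (omx 4 (sixv a b c d e f)) =
  omx 8 (let n := None in
    [:: [:: a; n; n; n; n; n; n; n]; [:: n; b; c; n; n; n; n; n];
        [:: n; d; e; n; n; n; n; n]; [:: n; n; n; f; n; n; n; n];
        [:: n; n; n; n; a; n; n; n]; [:: n; n; n; n; n; b; c; n];
        [:: n; n; n; n; n; d; e; n]; [:: n; n; n; n; n; n; n; f]]).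
Proof.
apply/matrixP=> i j; rewrite !mxE.
ord_cases i; ord_cases j; by rewrite /= ?(mul1r, mul0r).
Qed.

Lemma Pmx_sixv : Pmx C =
  omx 4 (sixv (Some 1) None (Some 1) (Some 1) None (Some (-1))).
Proof. by apply/matrixP=> i j; rewrite !mxE; ord_cases i; ord_cases j. Qed.

(* [R (z / w)] multiplied by [q ^+ 2 * z - w] *)
Definition Rnum (q z w : C) : 'M[C]_(2 * 2) :=
  omx 4 (sixv (Some (q ^+ 2 * z - w)) (Some (q * (z - w)))
    (Some (w * (q ^+ 2 - 1))) (Some (z * (q ^+ 2 - 1)))
    (Some (q * (z - w))) (Some (z - q ^+ 2 * w))).

Lemma Rmx_num q z w : q != 0 -> w != 0 -> R_regular q (z / w) ->
  Rmx q (z / w) = (q ^+ 2 * z - w)^-1 *: Rnum q z w.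
Proof.
move=> q0 w0 reg; have D0 : q ^+ 2 * z - w != 0.
  (* The cleared denominator is a unit multiple of the one that [R_regular] keeps away from zero. *)
  have -> : q ^+ 2 * z - w = q * w * (q * (z / w) - q^-1) by field; rewrite q0.
  by rewrite !mulf_neq0.
apply/matrixP=> i j; rewrite !mxE /rR.
ord_cases i; ord_cases j; rewrite /= ?mulr0 //; field; rewrite ?q0 ?w0 ?D0 //.
Qed.

(* The commutant of the vector representation on [V (x) W] is spanned by [1] and
   by the coefficient of [b], which is [- (1 + q ^+ 2)] times a projector. *)
Definition Kmx (q x b : C) : 'M[C]_(2 * 2) :=
  omx 4 (sixv (Some x) (Some (x - b)) (Some (q * b))
    (Some (q * b)) (Some (x - q ^+ 2 * b)) (Some (x - (1 + q ^+ 2) * b))).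

Definition Kx (q s z : C) := (q ^+ 2 * z - s) * (q ^+ 2 * s * z - 1).
Definition Kb (q s z : C) := (1 - q ^+ 2) * (1 - z ^+ 2) * s.

(* [Kb] vanishes at [z ^+ 2 = 1], and [Kx] with it if [s = z * q ^+ 2] or
   [s = z / q ^+ 2]; the identity is a valid choice for all [s], as the
   reflection equation then reduces to the unitarity of [R]. *)
Definition Ksol (q s z : C) :=
  if z ^+ 2 == 1 then Kmx q 1 0 else Kmx q (Kx q s z) (Kb q s z).

Definition RE_num q z w (Kz Kw : 'M[C]_(2 * 2)) :=
  on21 (Rnum q z w) *m on13 Kz *m on12 (Rnum q (z * w) 1) *m on23 Kw
  = on23 Kw *m on21 (Rnum q (z * w) 1) *m on13 Kz *m on12 (Rnum q z w).

Ltac RE_tac := rewrite /RE_num /on21 /on13 Pmx_sixv /Rnum /Kmx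
  !on12_sixv !on23_sixv; omx_compute; omx_entries; ring.

Lemma RE_num_generic q s z w :
  RE_num q z w (Kmx q (Kx q s z) (Kb q s z)) (Kmx q (Kx q s w) (Kb q s w)).
Proof. rewrite /Kx /Kb; RE_tac. Qed.

(** For [z = 1] or [z = -1] the arguments [z / w] and [z * w] are inverse to each other. With the
    identity as first K-matrix, each side is [K(w)] times a product of two R-matrices that unitarity
    makes scalar. *)
Lemma RE_num_left1 q w x b : RE_num q 1 w (Kmx q 1 0) (Kmx q x b).
Proof. RE_tac. Qed.

Lemma RE_num_leftN1 q w x b : RE_num q (-1) w (Kmx q 1 0) (Kmx q x b).
Proof. RE_tac. Qed.

(** For [w = 1] or [w = -1] the arguments [z / w] and [z * w] coincide, so both sides have the same
    factors; at [w = -1] the two numerators differ by a sign that occurs once on each side. *)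
Lemma RE_num_right1 q z x b : RE_num q z 1 (Kmx q x b) (Kmx q 1 0).
Proof. RE_tac. Qed.

Lemma RE_num_rightN1 q z x b : RE_num q z (-1) (Kmx q x b) (Kmx q 1 0).
Proof. RE_tac. Qed.

Lemma RE_num_Ksol q s z w : RE_num q z w (Ksol q s z) (Ksol q s w).
Proof.
have cases (u : C) : u ^+ 2 == 1 -> u = 1 \/ u = -1.
  by rewrite sqrf_eq1 => /orP[]/eqP; [left | right].
rewrite /Ksol; case: ifP => [/cases[]->|_].
- by case: ifP => _; exact: RE_num_left1.
- by case: ifP => _; exact: RE_num_leftN1.
case: ifP => [/cases[]->|_]; first exact: RE_num_right1.
  exact: RE_num_rightN1.
exact: RE_num_generic.
Qed.

Lemma on12Z (c : C) X : on12 (c *: X) = c *: on12 X.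
Proof. by apply/matrixP=> i j; rewrite !mxE mulrA. Qed.

Lemma on21Z (c : C) X : on21 (c *: X) = c *: on21 X.
Proof. by rewrite /on21 on12Z -scalemxAr -scalemxAl. Qed.

Lemma reflection_equation_Ksol q s z w : q != 0 -> w != 0 ->
  R_regular q (z / w) -> R_regular q (z * w) ->
  reflection_equation q (Ksol q s) z w.
Proof.
move=> q0 w0 r1 r2; rewrite /reflection_equation.
have -> : z * w = z * w / 1 by rewrite divr1.
rewrite !Rmx_num ?oner_eq0 ?divr1 //.
rewrite !on12Z !on21Z -!(scalemxAl, scalemxAr) !scalerA.
(* Both sides carry the same two inverse denominators, in opposite order. *)
by rewrite [_^-1 * _]mulrC; congr (_ *: _); apply: RE_num_Ksol.
Qed.

End ReflectionEquation.

(** * Calculus in the graded tensor square *)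

Section GradedTensor.
Variable C : numFieldType.

Section Homogeneous.
Variable A : superalgebra C.

(** The components are the projections to the eigenspaces of the parity involution; [2] is
    invertible in [C]. *)
Lemma homogeneous_split (a : A) : exists a0 a1 : A,
  [/\ homogeneous false a0, homogeneous true a1 & a = a0 + a1].
Proof.
exists (2%:R^-1 *: (a + parity A a)), (2%:R^-1 *: (a - parity A a)).
split; rewrite /homogeneous ?linearZ /= ?linearD ?linearN /= ?parityK.
- by rewrite expr0 !scale1r addrC.
- by rewrite expr1 !scaleN1r !scalerN opprK addrC.
rewrite addrACA subrr addr0 -mulr2n -scaler_nat scalerA mulfV ?scale1r //.
by rewrite Num.Theory.pnatr_eq0.
Qed.

Lemma homogeneousM p p' (a b : A) :
  homogeneous p a -> homogeneous p' b -> homogeneous (p (+) p') (a * b).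
Proof.
move=> ha hb; rewrite /homogeneous rmorphM /= ha hb.
by rewrite -scalerAl -scalerAr scalerA signr_addb.
Qed.

Lemma homogeneousB p (a b : A) :
  homogeneous p a -> homogeneous p b -> homogeneous p (a - b).
Proof. by move=> ha hb; rewrite /homogeneous rmorphB /= ha hb scalerBr. Qed.

Lemma homogeneousZ p c (a : A) : homogeneous p a -> homogeneous p (c *: a).
Proof. by move=> ha; rewrite /homogeneous linearZ /= ha !scalerA mulrC. Qed.

End Homogeneous.

Variables (A : superalgebra C) (AA : graded_tensor A A).
Local Notation "a '\ox' b" := (tens AA a b) (at level 40).

Lemma tensDl (a a' b : A) : (a + a') \ox b = a \ox b + a' \ox b.
Proof. by have [/(_ b 1 a a') + _] := tens_bilinear AA; rewrite !scale1r. Qed.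

Lemma tensDr (a b b' : A) : a \ox (b + b') = a \ox b + a \ox b'.
Proof. by have [_ /(_ a 1 b b')] := tens_bilinear AA; rewrite !scale1r. Qed.

Lemma tens0l (b : A) : 0 \ox b = 0.
Proof. by apply: (addrI (0 \ox b)); rewrite -tensDl !addr0. Qed.

Lemma tens0r (a : A) : a \ox 0 = 0.
Proof. by apply: (addrI (a \ox 0)); rewrite -tensDr !addr0. Qed.

Lemma tensZl c (a b : A) : (c *: a) \ox b = c *: (a \ox b).
Proof.
have [/(_ b c a 0) + _] := tens_bilinear AA.
by rewrite !addr0 tens0l addr0.
Qed.

Lemma tensZr c (a b : A) : a \ox (c *: b) = c *: (a \ox b).
Proof.
have [_ /(_ a c b 0)] := tens_bilinear AA.
by rewrite !addr0 tens0r addr0.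
Qed.

Lemma tensBl (a a' b : A) : (a - a') \ox b = a \ox b - a' \ox b.
Proof. by rewrite tensDl -scaleN1r tensZl scaleN1r. Qed.

Lemma tensBr (a b b' : A) : a \ox (b - b') = a \ox b - a \ox b'.
Proof. by rewrite tensDr -scaleN1r tensZr scaleN1r. Qed.

(** An even element crosses anything without a sign, so [a'] may be inhomogeneous: the Koszul rule
    applies to each of its components. *)
Lemma tensM_evenl (a b a' b' : A) : homogeneous false b ->
  (a \ox b) * (a' \ox b') = (a * a') \ox (b * b').
Proof.
move=> hb; have [a0 [a1 [h0 h1 ->]]] := homogeneous_split a'.
rewrite tensDl mulrDr (tensM _ _ _ hb h0) (tensM _ _ _ hb h1) !scale1r.
by rewrite -tensDl -mulrDr.
Qed.

Lemma tensM_evenr (a b a' b' : A) : homogeneous false a' ->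
  (a \ox b) * (a' \ox b') = (a * a') \ox (b * b').
Proof.
move=> ha'; have [b0 [b1 [h0 h1 ->]]] := homogeneous_split b.
rewrite tensDr mulrDl (tensM _ _ _ h0 ha') (tensM _ _ _ h1 ha') !scale1r.
by rewrite -tensDr -mulrDl.
Qed.

Lemma tensM_odd (a b a' b' : A) : homogeneous true b -> homogeneous true a' ->
  (a \ox b) * (a' \ox b') = - ((a * a') \ox (b * b')).
Proof. by move=> hb ha'; rewrite (tensM _ _ _ hb ha') expr1 scaleN1r. Qed.

(** Makes [tens_ext] usable for maps such as [u |-> L (u * v)], which carry no declared linear
    structure. *)
Lemma tens_ext_linear (M : lmodType C) (g h : AA -> M) : linear g -> linear h ->
  (forall a b, g (a \ox b) = h (a \ox b)) -> g =1 h.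
Proof.
move=> gP hP; pose g' := HB.pack_for {linear AA -> M} g
  (GRing.isLinear.Build _ _ _ _ g gP).
pose h' := HB.pack_for {linear AA -> M} h (GRing.isLinear.Build _ _ _ _ h hP).
exact: (tens_ext (g := g') (h := h')).
Qed.

End GradedTensor.

(** * The graded Kronecker product of matrices *)

Section GradedKronecker.
Variable C : numFieldType.
Implicit Types X Y : 'M[C]_2.

Local Notation S := (sgnV C).

(** Since [S] squares to one, this is parity with respect to conjugation by [S]. *)
Definition mx_homogeneous (p : bool) Y := S *m Y = (-1) ^+ p *: (Y *m S).

Lemma sgnVK : S *m S = 1%:M.
Proof.
apply/matrixP=> i j; rewrite /sgnV /e !mxE big_ord_recl big_ord1 !mxE.
by ord_cases i; ord_cases j; rewrite /= ?(mulr0n, mulr1n) ; ring.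
Qed.

Lemma tensmxZl m n p r (c : C) (X : 'M_(m, n)) (Y : 'M_(p, r)) :
  (c *: X) *t Y = c *: (X *t Y).
Proof. by apply/matrixP=> i j; rewrite !mxE mulrA. Qed.

Lemma gkron_homogeneous p X Y : mx_homogeneous p Y ->
  gkron X Y = (if p then X *m S else X) *t Y.
Proof.
have h2 : 2%:R^-1 *: (Y + Y) = Y.
  by rewrite -mulr2n -scaler_nat scalerA mulVf ?scale1r ?Num.Theory.pnatr_eq0.
rewrite /gkron => ->; rewrite -scalemxAl -mulmxA sgnVK mulmx1; case: p.
  by rewrite expr1 scaleN1r subrr opprK h2 scaler0 tensmx0 add0r.
by rewrite expr0 scale1r subrr h2 scaler0 tensmx0 addr0.
Qed.

(** An odd [Y] puts [S] on the first leg, and moving this [S] past [X'] produces the Koszul sign.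
    Such a [Y] also exchanges the even and odd parts of the second leg, so the two summands of
    [gkron] trade places. *)
Lemma gkronM p p' X Y X' Y' : mx_homogeneous p Y -> mx_homogeneous p' X' ->
  gkron X Y *m gkron X' Y' = (-1) ^+ (p && p') *: gkron (X *m X') (Y *m Y').
Proof.
move=> hY hX; rewrite (gkron_homogeneous _ hY) /gkron.
have SYY : S *m (Y *m Y') *m S = (-1) ^+ p *: (Y *m (S *m Y' *m S)).
  by rewrite mulmxA hY -!scalemxAl !mulmxA.
rewrite SYY; move: sgnVK hX {hY SYY}; rewrite /mx_homogeneous.
move: (sgnV C) => s ss1 hX.
rewrite mulmxDr !tensmx_mul -!scalemxAr mulmxDr mulmxBr.
case: p => /=; last by rewrite expr0 !scale1r [X *m (X' *m s)]mulmxA.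
rewrite expr1 !scaleN1r opprK -!mulmxA [s *m (X' *m s)]mulmxA hX.
rewrite -!scalemxAl -!scalemxAr -[X' *m s *m s]mulmxA ss1 mulmx1.
by rewrite !tensmxZl -scalerDr addrC.
Qed.

Lemma gkron1 : gkron 1%:M 1%:M = 1%:M :> 'M[C]_(2 * 2).
Proof.
rewrite (@gkron_homogeneous false).
  apply/matrixP=> i j; rewrite !mxE.
  by ord_cases i; ord_cases j; rewrite /= ?(mulr0, mul0r, mulr1).
by rewrite /mx_homogeneous mulmx1 mul1mx scale1r.
Qed.

End GradedKronecker.

Lemma mx_homogeneous_rep (C : numFieldType) (q : C) (A : Uq_affine_gl11 q) z
    (T : {lrmorphism A -> 'M[C]_2}) p a :
  evaluation_representation z T -> homogeneous p a -> mx_homogeneous p (T a).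
Proof.
case=> hP _ _ _ ha; rewrite /mx_homogeneous scalemxAl.
have <- : T (parity A a) = (-1) ^+ p *: T a by rewrite ha linearZ.
by rewrite hP -[RHS]mulmxA sgnVK mulmx1.
Qed.

(** * Multiplicativity of the tensor product of representations *)

Section RepTens.
Variables (C : numFieldType) (q : C) (A : Uq_affine_gl11 q).
Variables (z z' : C) (T T' : {lrmorphism A -> 'M[C]_2}).
Hypotheses (hT : evaluation_representation z T)
  (hT' : evaluation_representation z' T').

Lemma rep_tensE a b : rep_tens T T' (tens (uq_tens A) a b) = gkron (T a) (T' b).
Proof. exact: tens_liftE. Qed.

Lemma rep_tens1 : rep_tens T T' 1 = 1%:M.
Proof. by rewrite -tens1 rep_tensE !rmorph1 gkron1. Qed.

(** Both sides are bilinear, so elementary tensors suffice, and then those whose inner factors [b]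
    and [a'] are homogeneous; there [tensM] and [gkronM] give the same sign. *)
Lemma rep_tensM : {morph rep_tens T T' : u v / u * v >-> u *m v}.
Proof.
set L := rep_tens T T' => u v; move: u.
apply: (tens_ext_linear (g := fun u => L (u * v)) (h := fun u => L u *m L v)).
- by move=> c u w; rewrite mulrDl -scalerAl linearP.
- by move=> c u w; rewrite linearP mulmxDl scalemxAl.
move=> a b; move: v; apply: (tens_ext_linear (g := fun v => L (_ * v))
  (h := fun v => L _ *m L v)).
- by move=> c v w; rewrite mulrDr -scalerAr linearP.
- by move=> c v w; rewrite linearP mulmxDr scalemxAr.
move=> a' b'.
have [b0 [b1 [hb0 hb1 ->]]] := homogeneous_split b.
have [a0 [a1 [ha0 ha1 ->]]] := homogeneous_split a'.
have H p p' (c d : A) : homogeneous p c -> homogeneous p' d ->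
    L (tens _ a c * tens _ d b') = L (tens _ a c) *m L (tens _ d b').
  move=> hc hd; rewrite (tensM _ _ _ hc hd) linearZ /L !rep_tensE !rmorphM /=.
  by rewrite (gkronM _ _ (mx_homogeneous_rep hT' hc) (mx_homogeneous_rep hT hd)).
rewrite !tensDr !tensDl !mulrDl !mulrDr !linearD /= !mulmxDl.
by rewrite !(H _ _ _ _ hb0 ha0) !(H _ _ _ _ hb0 ha1) !(H _ _ _ _ hb1 ha0)
  !(H _ _ _ _ hb1 ha1) addrACA.
Qed.

End RepTens.

(** * The left coideal property *)

Section SubalgebraGen.
Variables (C : numFieldType) (A : algType C) (X : A -> Prop).
Local Notation B := (subalgebra_gen X).

Lemma subalgebra_gen0 : B 0.
Proof.
by have := sg_lin (-1) (sg_one X) (sg_one X); rewrite scaleN1r addNr.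
Qed.

Lemma subalgebra_genD a b : B a -> B b -> B (a + b).
Proof. by move=> Ba; move/(sg_lin 1 Ba); rewrite scale1r. Qed.

Lemma subalgebra_genZ c a : B a -> B (c *: a).
Proof. by move=> Ba; have := sg_lin c Ba subalgebra_gen0; rewrite addr0. Qed.

End SubalgebraGen.

Section LeftCoideal.
Variables (C : numFieldType) (q : C) (A : Uq_affine_gl11 q).
Local Notation "a '\ox' b" := (tens (uq_tens A) a b) (at level 40).

Lemma kV_even i : homogeneous false (kV A i).
Proof.
rewrite /homogeneous expr0 scale1r -[LHS]mul1r -[X in X * _](kVk A i) -mulrA.
have {1}-> : k A i = parity A (k A i) by rewrite k_even expr0 scale1r.
by rewrite -rmorphM kkV rmorph1 mulr1.
Qed.

(** Both sides are inverse to [k A i \ox k A i]. *)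
Lemma Delta_kV i : Delta A (kV A i) = kV A i \ox kV A i.
Proof.
rewrite -[LHS]mulr1 -(tens1 (uq_tens A)) -{1}(kkV A i) -{1}(kkV A i).
rewrite -tensM_evenl; last exact: k_even.
by rewrite -Delta_k mulrA -rmorphM kVk rmorph1 mul1r.
Qed.

(** The row of [ahat] for [k_1] vanishes at both Chevalley columns. *)
Lemma k1_xip j : k A (cidx i1) * xip A j = xip A j * k A (cidx i1).
Proof.
have := k_xip A (cidx i1) j.
have -> : ahat (cidx i1) (cidx j) = 0.
  by rewrite /ahat !mxE; ord_cases j.
rewrite expr0z scale1r => {2}<-.
by rewrite -!mulrA kVk mulr1.
Qed.

Lemma kV1_xip j : kV A (cidx i1) * xip A j = xip A j * kV A (cidx i1).
Proof.
rewrite -[LHS]mulr1 -(kkV A (cidx i1)) -!mulrA [xip A j * (_ * _)]mulrA -k1_xip.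
by rewrite !mulrA kVk mul1r.
Qed.

Lemma xip'_odd : homogeneous true (xip' A).
Proof. exact (homogeneousM (kV_even (cidx i1)) (xip_odd A i1)). Qed.

Lemma Delta_xip' : Delta A (xip' A) = xip' A \ox kV A (cidx i1) + 1 \ox xip' A.
Proof.
rewrite rmorphM /= Delta_kV Delta_xip mulrDr.
by rewrite !tensM_evenl ?mulr1 ?kVk //; exact: kV_even.
Qed.

(** In the coproduct of the commutator the cross terms with [h2p] alone on one leg cancel, while the
    extra term of [Delta_h2p] contributes an anticommutator on the left leg. Every right leg that
    remains lies in the coideal subalgebra. *)
Lemma Delta_B0m d : Delta A (B0m A d) =
  xim A i0 \ox kV A (cidx i0)
  - d *: ((h2p A * xip' A - xip' A * h2p A) \ox kV A (cidx i1))
  + (2%:R * d) *: ((xip A i0 * xip A i1 + xip A i1 * xip A i0) \ox xip' A)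
  + 1 \ox B0m A d.
Proof.
have kVe := kV_even (cidx i1); have ho := h2p_even A.
have xo := xip_odd A i1; have x'o := xip'_odd.
have xk : homogeneous true (xip A i0 * k A (cidx i1)).
  exact (homogeneousM (xip_odd A i0) (k_even A (cidx i1))).
have h1 : homogeneous false (1 : A) by rewrite /homogeneous rmorph1 scale1r.
have kx' : k A (cidx i1) * xip' A = xip A i1 by rewrite mulrA kkV mul1r.
have x'k : xip' A * xip A i0 * k A (cidx i1) = xip A i1 * xip A i0.
  by rewrite -mulrA -k1_xip mulrA /xip' kV1_xip -[_ * _ * k _ _]mulrA kVk mulr1.
(* The next two identities kill the products in which the right legs [xip A i1] and [xip' A]
   meet. *)
have x'x : xip' A * xip A i1 = 0 by rewrite -mulrA xip_sq mulr0.
have xx' : xip A i1 * xip' A = 0 by rewrite /xip' kV1_xip mulrA xip_sq mul0r.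
have hkV : h2p A * kV A (cidx i1) = kV A (cidx i1) * h2p A.
  rewrite -[LHS]mul1r -(kVk A (cidx i1)) -!mulrA [k _ _ * (_ * _)]mulrA k_h2p.
  by rewrite -[h2p A * _ * _]mulrA kkV mulr1.
rewrite {1}/B0m linearB linearZ linearB /= Delta_xim.
rewrite (rmorphM _ (h2p A)) (rmorphM _ (xip' A)) /=.
rewrite Delta_h2p Delta_xip' !mulrDl !mulrDr.
rewrite -!scalerAl -!scalerAr.
rewrite (tensM_evenl _ _ _ _ h1) (tensM_evenl _ _ _ _ h1).
rewrite (tensM_evenl _ _ _ _ ho) (tensM_evenl _ _ _ _ ho).
rewrite (tensM_odd _ _ _ xo x'o) (tensM_evenr _ _ _ _ h1).
rewrite (tensM_evenr _ _ _ _ ho) (tensM_evenr _ _ _ _ h1) (tensM_evenl _ _ _ _ kVe).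
rewrite (tensM_evenr _ _ _ _ ho) (tensM_evenr _ _ _ _ h1) (tensM_odd _ _ _ x'o xk).
rewrite !mulr1 !mul1r hkV -[_ * k _ _ * _]mulrA kx' mulrA x'k -kV1_xip x'x xx'.
rewrite !tens0r oppr0 !scaler0 !addr0 -/(xip' A) scalerN.
rewrite /B0m tensBr tensZr !tensBl tensBr tensDl.
set w1 := (h2p A * xip' A) \ox _; set w2 := h2p A \ox _.
set w3 := xip' A \ox _; set w4 := 1 \ox (h2p A * _).
set w5 := (xip' A * h2p A) \ox _.
set w6 := 1 \ox (xip' A * _); set f := _ \ox xip' A; set g := _ \ox xip' A.
(* The cross terms [w2] and [w3] arise in both orders of multiplication and cancel. *)
have -> : w1 + w2 + (w3 + w4) - 2%:R *: f
    - (w5 + w3 + 2%:R *: g + (w2 + w6))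
  = w1 - w5 + (w4 - w6) - 2%:R *: (f + g).
  rewrite scalerDr !opprD !addrA (ACl (1*6*4*10*5*8*2*9*3*7)%AC) /=.
  by rewrite !addrK.
have -> : d + d = d * 2%:R by rewrite mulr_natr mulr2n.
rewrite scalerBr scalerDr scalerA opprB addrCA opprD !addrA.
by rewrite (ACl (2*4*1*3*5)%AC).
Qed.

(** An inductive form of the finite sums in [left_coideal], chosen so that closure under products is
    proved by induction rather than by reindexing. *)
Inductive tens_span (B : A -> Prop) : uq_tens A -> Prop :=
| tens_span0 : tens_span B 0
| tens_spanS a b u : B b -> tens_span B u -> tens_span B (a \ox b + u).

Lemma tens_spanP (B : A -> Prop) u : tens_span B u ->
  exists (n : nat) (x y : 'I_n -> A),
    (forall i, B (y i)) /\ u = \sum_(i < n) x i \ox y i.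
Proof.
elim=> [|a b v Bb _ [n [x [y [By ->]]]]].
  by exists 0, (fun=> 0), (fun=> 0); split=> [[]|]; rewrite ?big_ord0.
exists n.+1, (fun i => oapp x a (unlift ord0 i)),
  (fun i => oapp y b (unlift ord0 i)); split=> [i|].
  by case: (unlift ord0 i) => [j|] /=.
rewrite big_ord_recl unlift_none; congr (_ + _).
by apply: eq_bigr => i _; rewrite liftK.
Qed.

Section TensSpan.
Variable X : A -> Prop.
Local Notation B := (subalgebra_gen X).

Lemma tens_span1 a b : B b -> tens_span B (a \ox b).
Proof.
move=> Bb; rewrite -[_ \ox _]addr0.
by apply: tens_spanS => //; exact: tens_span0.
Qed.

Lemma tens_spanD u v : tens_span B u -> tens_span B v -> tens_span B (u + v).
Proof.
move=> Bu Bv; elim: Bu => [|a b w Bb _ IHw]; first by rewrite add0r.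
by rewrite -addrA; exact: tens_spanS.
Qed.

Lemma tens_spanZ c u : tens_span B u -> tens_span B (c *: u).
Proof.
elim=> [|a b w Bb _ IHw]; first by rewrite scaler0; exact: tens_span0.
by rewrite scalerDr -tensZl; exact: tens_spanS.
Qed.

Hypothesis B_parity : forall b, B b -> B (parity A b).

Lemma subalgebra_gen_split b : B b -> exists b0 b1 : A,
  [/\ B b0, B b1, homogeneous false b0, homogeneous true b1 & b = b0 + b1].
Proof.
move=> Bb; have [b0 [b1 [h0 h1 eb]]] := homogeneous_split b.
have ePb : parity A b = b0 - b1.
  by rewrite eb rmorphD /= h0 h1 expr0 expr1 scale1r scaleN1r.
have half (x : A) : x = 2%:R^-1 *: (x + x).
  by rewrite -mulr2n -scaler_nat scalerA mulVf ?scale1r ?Num.Theory.pnatr_eq0.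
exists b0, b1; split=> //.
  rewrite [b0]half; apply: subalgebra_genZ.
  have -> : b0 + b0 = b + parity A b by rewrite ePb eb addrACA subrr addr0.
  by apply: subalgebra_genD => //; exact: B_parity.
rewrite [b1]half; apply: subalgebra_genZ.
have -> : b1 + b1 = b + (-1) *: parity A b.
  by rewrite ePb eb scaleN1r opprB [b0 + b1]addrC addrACA subrr addr0.
by apply: subalgebra_genD => //; apply: subalgebra_genZ; exact: B_parity.
Qed.

(** The Koszul rule needs the right leg [b] of the first factor to be homogeneous. Stability of [B]
    under parity allows [b] to be split without leaving [B]. *)
Lemma tens_spanM u v : tens_span B u -> tens_span B v -> tens_span B (u * v).
Proof.
have mul1 p (a b a' b' : A) : homogeneous p b -> B b -> B b' ->
    tens_span B ((a \ox b) * (a' \ox b')).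
  move=> hb Bb Bb'; have [a0 [a1 [h0 h1 ->]]] := homogeneous_split a'.
  rewrite tensDl mulrDr (tensM _ _ _ hb h0) (tensM _ _ _ hb h1).
  by apply: tens_spanD; apply: tens_spanZ; apply: tens_span1; apply: sg_mul.
move=> Bu Bv; elim: Bu => [|a b {}u Bb _ IHu].
  by rewrite mul0r; exact: tens_span0.
rewrite mulrDl; apply: tens_spanD => //.
elim: Bv {IHu} => [|a' b' {}v Bb' _ IHv]; first by rewrite mulr0; exact: tens_span0.
rewrite mulrDr; apply: tens_spanD => //.
have [b0 [b1 [Bb0 Bb1 h0 h1 ->]]] := subalgebra_gen_split Bb.
by rewrite tensDr mulrDl; apply: tens_spanD;
  [exact: mul1 h0 _ _|exact: mul1 h1 _ _].
Qed.

End TensSpan.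

Lemma B0m_odd d : homogeneous true (B0m A d).
Proof.
apply: homogeneousB; first exact: xim_odd.
apply: homogeneousZ; apply: homogeneousB.
  exact (homogeneousM (h2p_even A) xip'_odd).
exact (homogeneousM xip'_odd (h2p_even A)).
Qed.

Lemma coideal_gens_homogeneous d g :
  coideal_gens d g -> exists p, @homogeneous _ A p g.
Proof.
case=> [i|i|||].
- by exists false; exact: k_even.
- by exists false; exact: kV_even.
- by exists true; exact: xip_odd.
- by exists true; exact: xim_odd.
by exists true; exact: B0m_odd.
Qed.

(** Parity multiplies each generator by a sign, as all of them are homogeneous. *)
Lemma coideal_subalgebra_parity d b :
  coideal_subalgebra (A := A) d b -> coideal_subalgebra d (parity A b).
Proof.
elim=> [g gg||c a {}b _ Ba _ Bb|a {}b _ Ba _ Bb].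
- have [p ->] := coideal_gens_homogeneous gg.
  by apply: subalgebra_genZ; exact: sg_gen.
- by rewrite rmorph1; exact: sg_one.
- by rewrite linearP; exact: sg_lin.
by rewrite rmorphM; exact: sg_mul.
Qed.

Lemma coideal_subalgebra_left_coideal d :
  left_coideal (coideal_subalgebra (A := A) d).
Proof.
pose B := coideal_subalgebra (A := A) d.
have Bxip : B (xip A i1) by apply: sg_gen; constructor.
have BkV i : B (kV A i) by apply: sg_gen; constructor.
move=> b Bb; apply: tens_spanP.
elim: Bb => [g gg||c a {}b _ Ba _ Bb|a {}b _ Ba _ Bb].
- have Bg : B g by exact: sg_gen.
  case: gg Bg => [i|i|||] Bg.
  + by rewrite Delta_k; exact: tens_span1.
  + by rewrite Delta_kV; exact: tens_span1.
  + rewrite Delta_xip; apply: tens_spanD; apply: tens_span1 => //; exact: sg_one.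
  + rewrite Delta_xim; apply: tens_spanD; apply: tens_span1; [exact: BkV|exact: Bg].
  + rewrite Delta_B0m -scaleNr.
    apply: tens_spanD; last exact: tens_span1.
    do 2?[apply: tens_spanD]; rewrite -?tensZl; apply: tens_span1;
      [exact: BkV|exact: BkV|exact: sg_mul (BkV _) Bxip].
- by rewrite rmorph1 -(tens1 (uq_tens A)); apply: tens_span1; exact: sg_one.
- by rewrite linearP; apply: tens_spanD => //; exact: tens_spanZ.
by rewrite rmorphM; apply: tens_spanM => //; exact: coideal_subalgebra_parity.
Qed.

End LeftCoideal.

(** * Explicit matrices of the generators on [V (x) W] *)

Section GeneratorImages.
Variables (C : numFieldType) (q : C) (A : Uq_affine_gl11 q).
Hypothesis q0 : q != 0.

Local Notation e := (e C).

Lemma e_scalar : e i0 i0 + e i1 i1 = 1%:M.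
Proof.
by apply/matrixP=> i j; rewrite !mxE; ord_cases i; ord_cases j;
  rewrite /= ?(addr0, add0r).
Qed.

Lemma mul_sgnV (X : 'M[C]_2) :
  X *m sgnV C = \matrix_(i, j) (X i j * (-1) ^+ j).
Proof.
have -> : sgnV C = diag_mx (\row_j (-1) ^+ j).
  apply/matrixP=> i j; rewrite !mxE.
  by ord_cases i; ord_cases j; rewrite /= ?subr0 ?sub0r.
by rewrite mul_mx_diag; apply/matrixP=> i j; rewrite !mxE.
Qed.

Lemma rep_kV1 z T : evaluation_representation z T ->
  T (kV A (cidx i1)) = q^-1 *: 1%:M.
Proof.
case=> _ _ [Tk _ _] _; have := kkV A (cidx i1); move/(congr1 T).
rewrite rmorphM rmorph1 /= Tk e_scalar -mulmxE => H.
by rewrite -[1%:M]H -scalemxAl mul1mx scalerA mulVf // scale1r.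
Qed.

Lemma rep_kV0 z T : evaluation_representation z T ->
  T (kV A (cidx i0)) = q *: 1%:M.
Proof.
case=> _ _ [_ Tk _] _; have := kkV A (cidx i0); move/(congr1 T).
rewrite rmorphM rmorph1 /= Tk e_scalar -mulmxE => H.
by rewrite -[1%:M]H -scalemxAl mul1mx scalerA divff // scale1r.
Qed.

Variables (z s : C) (T T' : {lrmorphism A -> 'M[C]_2}).
Hypotheses (hT : evaluation_representation z T)
  (hT' : evaluation_representation s T').
Local Notation rep u := (rep_tens T T' u).

Lemma rep_tens_homogeneous p a b : homogeneous p b ->
  rep (tens (uq_tens A) a b) = (if p then T a *m sgnV C else T a) *t T' b.
Proof.
move=> hb; rewrite rep_tensE; apply: gkron_homogeneous.
exact (mx_homogeneous_rep hT' hb).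
Qed.

Lemma homogeneous1 : homogeneous false (1 : A).
Proof. by rewrite /homogeneous rmorph1 expr0 scale1r. Qed.

Ltac entries := let i := fresh "i" in let j := fresh "j" in
  apply/matrixP=> i j; rewrite !mxE;
  ord_cases i; ord_cases j; rewrite /=.

Lemma rep_Delta_k0 : rep (Delta A (k A (cidx i0))) = (q^-1 ^+ 2)%:M.
Proof.
rewrite Delta_k (rep_tens_homogeneous _ (k_even A _)).
have [_ _ [_ -> _] _] := hT; have [_ _ [_ -> _] _] := hT'.
by rewrite e_scalar; entries; ring.
Qed.

Lemma rep_Delta_k1 : rep (Delta A (k A (cidx i1))) = (q ^+ 2)%:M.
Proof.
rewrite Delta_k (rep_tens_homogeneous _ (k_even A _)).
have [_ _ [-> _ _] _] := hT; have [_ _ [-> _ _] _] := hT'.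
by rewrite e_scalar; entries; ring.
Qed.

Lemma rep_Delta_k2 : rep (Delta A (k A ord_max)) =
  omx 4 (sixv (Some (q ^+ 2)) (Some 1) None None (Some 1) (Some (q^-1 ^+ 2))).
Proof.
rewrite Delta_k (rep_tens_homogeneous _ (k_even A _)).
have [_ _ [_ _ ->] _] := hT; have [_ _ [_ _ ->] _] := hT'.
by entries; field.
Qed.

Lemma rep_Delta_xip1 : rep (Delta A (xip A i1)) = omx 4 (let n := None in
  [:: [:: n; Some q; Some 1; n]; [:: n; n; n; Some 1];
      [:: n; n; n; Some (- q)]; [:: n; n; n; n]]).
Proof.
rewrite Delta_xip linearD /= (rep_tens_homogeneous _ homogeneous1).
rewrite (rep_tens_homogeneous _ (xip_odd A _)) rmorph1.
have [_ [-> _ _ _] [-> _ _] _] := hT; have [_ [-> _ _ _] _ _] := hT'.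
by rewrite mul_sgnV; entries; ring.
Qed.

Lemma rep_Delta_xim1 : rep (Delta A (xim A i1)) = omx 4 (let n := None in
  [:: [:: n; n; n; n]; [:: Some 1; n; n; n];
      [:: Some q^-1; n; n; n]; [:: n; Some q^-1; Some (-1); n]]).
Proof.
rewrite Delta_xim linearD /= (rep_tens_homogeneous _ (kV_even A _)).
rewrite (rep_tens_homogeneous _ (xim_odd A _)) rmorph1 (rep_kV1 hT').
have [_ [_ -> _ _] _ _] := hT; have [_ [_ -> _ _] _ _] := hT'.
by rewrite mul_sgnV; entries; ring.
Qed.

(** The amplitudes with which the twisted generator lowers the first and the second tensor factor
    from [v_2] to [v_1], where [u] is the spectral parameter of the first. In [Bbeta], the term in
    [u] comes from the anticommutator in [Delta_B0m] and the rest from the boundary space. *)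
Definition Balpha u := - (q / u + u / q).
Definition Bbeta u := (q ^- 2 - 1) * u - s - s^-1.

Hypotheses (q2 : q ^+ 2 != 1) (z0 : z != 0) (s0 : s != 0).

Lemma rep_xip' u U : evaluation_representation u U ->
  U (xip' A) = q^-1 *: e i0 i1.
Proof.
move=> hU; rewrite rmorphM /= (rep_kV1 hU).
by have [_ [-> _ _ _] _ _] := hU; rewrite -mulmxE -scalemxAl mul1mx.
Qed.

(** The image of [h2p] is a multiple of [sgnV], which anticommutes with [e i0 i1]; hence the
    commutator doubles the product. *)
Lemma rep_h2p_xip' u U : evaluation_representation u U ->
  U (h2p A * xip' A - xip' A * h2p A) =
    (2%:R * u / (q^-1 - q)) *: e i0 i1.
Proof.
move=> hU; rewrite rmorphB (rmorphM U (h2p A)).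
rewrite (rmorphM U (xip' A)) /= (rep_xip' hU).
have [_ _ _ ->] := hU; rewrite -!mulmxE.
have q2' : q^-1 - q != 0.
  apply: contra q2 => /eqP H; rewrite -subr_eq0.
  have -> : q ^+ 2 - 1 = - q * (q^-1 - q) by field.
  by rewrite H mulr0.
rewrite -!(scalemxAl, scalemxAr).
have -> : (e i0 i0 - e i1 i1) *m e i0 i1 = e i0 i1.
  rewrite /e mulmxBl !mul_delta_mx_cond /= ; entries; ring.
have -> : e i0 i1 *m (e i0 i0 - e i1 i1) = - e i0 i1.
  rewrite /e mulmxBr !mul_delta_mx_cond /= ; entries; ring.
rewrite !scalerN opprK !scalerA -scalerDl; congr (_ *: _).
by field; rewrite q0 mulNr subr_eq0 eq_sym -expr2.
Qed.

(** The chosen coefficient turns the commutator into exactly [u *: e i0 i1], so the image is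
    invariant under [u |-> u^-1]. *)
Lemma rep_B0m u U : evaluation_representation u U ->
  U (B0m A ((q^-1 - q) / 2%:R)) = - (u^-1 + u) *: e i0 i1.
Proof.
move=> hU; rewrite linearB linearZ /= (rep_h2p_xip' hU).
have [_ [_ _ _ ->] _ _] := hU.
rewrite scalerA -scalerBl; congr (_ *: _).
have -> : (q^-1 - q) / 2%:R * (2%:R * u / (q^-1 - q)) = u.
  by field; rewrite q0 mulNr subr_eq0 eq_sym -expr2.
by rewrite opprD.
Qed.

Lemma rep_xip01 u U : evaluation_representation u U ->
  U (xip A i0 * xip A i1 + xip A i1 * xip A i0) = u *: 1%:M.
Proof.
move=> hU; rewrite rmorphD !rmorphM /=.
have [_ [-> _ -> _] _ _] := hU; rewrite -!mulmxE -scalemxAl -scalemxAr.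
by rewrite -scalerDr /e !mul_delta_mx addrC e_scalar.
Qed.

Lemma rep_Delta_B0m : rep (Delta A (B0m A ((q^-1 - q) / 2%:R))) =
  omx 4 (let n := None in
  [:: [:: n; Some (Bbeta z); Some (Balpha z); n]; [:: n; n; n; Some (Balpha z)];
      [:: n; n; n; Some (- Bbeta z)]; [:: n; n; n; n]]).
Proof.
rewrite Delta_B0m !linearD linearN !linearZ /=.
rewrite !(rep_tens_homogeneous _ (kV_even A _)).
rewrite (rep_tens_homogeneous _ (xip'_odd A)).
rewrite (rep_tens_homogeneous _ (B0m_odd A _)).
rewrite (rep_B0m hT') (rep_h2p_xip' hT) (rep_xip01 hT).
rewrite (rmorph1 T) (rep_kV1 hT') (rep_kV0 hT') (rep_xip' hT').
have [_ [_ _ _ ->] _ _] := hT.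
have q2' : 1 + - q * q != 0 by rewrite mulNr subr_eq0 eq_sym -expr2.
rewrite !mul_sgnV /Bbeta /Balpha; entries.
all: rewrite ?(mulr0, mul0r, mulr1, mul1r) //.
all: by field; rewrite ?q0 ?z0 ?s0 ?q2'.
Qed.

End GeneratorImages.

(** * Existence and uniqueness of the intertwiner *)

Section Intertwiners.
Variables (C : numFieldType) (q : C) (A : Uq_affine_gl11 q).
Variable T : C -> {lrmorphism A -> 'M[C]_2}.
Hypothesis hT : forall z, z != 0 -> evaluation_representation z (T z).
Hypotheses (q0 : q != 0) (q2 : q ^+ 2 != 1) (q4 : q ^+ 4 != 1).
Variables s z : C.
Hypotheses (s0 : s != 0) (z0 : z != 0).
Let d := (q^-1 - q) / 2%:R.
Let zV0 : z^-1 != 0. Proof. by rewrite invr_eq0. Qed.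

Local Notation lhs b := (rep_tens (T z^-1) (T s) (Delta A b)).
Local Notation rhs b := (rep_tens (T z) (T s) (Delta A b)).
Local Notation hTV := (hT zV0).

Lemma intertwines_generators K :
  lhs (k A (cidx i0)) *m K = K *m rhs (k A (cidx i0)) ->
  lhs (k A (cidx i1)) *m K = K *m rhs (k A (cidx i1)) ->
  lhs (k A ord_max) *m K = K *m rhs (k A ord_max) ->
  lhs (xip A i1) *m K = K *m rhs (xip A i1) ->
  lhs (xim A i1) *m K = K *m rhs (xim A i1) ->
  lhs (B0m A d) *m K = K *m rhs (B0m A d) ->
  intertwines (coideal_subalgebra (A := A) d) T s z K.
Proof.
move=> k0K k1K k2K xipK ximK BK.
have kK i : lhs (k A i) *m K = K *m rhs (k A i).
  case: i => [[|[|[|i]]] lti] //; [move: k0K|move: k1K|move: k2K];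
    by congr (lhs (k A _) *m K = K *m rhs (k A _)); apply: val_inj.
(* The relation for [k A i] is multiplied by the image of the inverse on each side. *)
have kVK i : lhs (kV A i) *m K = K *m rhs (kV A i).
  have kl : lhs (kV A i) *m lhs (k A i) = 1%:M.
    by rewrite -(rep_tensM hTV (hT s0)) -rmorphM kVk rmorph1 rep_tens1.
  have kr : rhs (k A i) *m rhs (kV A i) = 1%:M.
    by rewrite -(rep_tensM (hT z0) (hT s0)) -rmorphM kkV rmorph1 rep_tens1.
  by rewrite -[LHS]mulmx1 -kr -!mulmxA [K *m (_ *m _)]mulmxA -kK !mulmxA kl mul1mx.
move=> b; elim=> {b} [g [] //||c a b _ Ka _ Kb|a b _ Ka _ Kb].
- by rewrite rmorph1 !rep_tens1 mul1mx mulmx1.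
- by rewrite !linearP /= mulmxDl -scalemxAl Ka Kb.
rewrite rmorphM (rep_tensM hTV (hT s0)) (rep_tensM (hT z0) (hT s0)).
by rewrite -mulmxA Kb !mulmxA Ka.
Qed.

(** The ratio is imposed in cross-multiplied form, so that it also makes sense where [Kb] or [Kx]
    vanishes. *)
Lemma Kmx_intertwines x b : x * Kb q s z = b * Kx q s z ->
  intertwines (coideal_subalgebra (A := A) d) T s z (Kmx q x b).
Proof.
move=> xb; apply: intertwines_generators.
- rewrite (rep_Delta_k0 hTV (hT s0)) (rep_Delta_k0 (hT z0) (hT s0)).
  by rewrite scalar_mxC.
- rewrite (rep_Delta_k1 hTV (hT s0)) (rep_Delta_k1 (hT z0) (hT s0)).
  by rewrite scalar_mxC.
- rewrite (rep_Delta_k2 q0 hTV (hT s0)) (rep_Delta_k2 q0 (hT z0) (hT s0)).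
  by rewrite /Kmx; omx_compute; omx_entries; field.
- rewrite (rep_Delta_xip1 hTV (hT s0)) (rep_Delta_xip1 (hT z0) (hT s0)).
  by rewrite /Kmx; omx_compute; omx_entries; field.
- rewrite (rep_Delta_xim1 q0 hTV (hT s0)) (rep_Delta_xim1 q0 (hT z0) (hT s0)).
  by rewrite /Kmx; omx_compute; omx_entries; field.
rewrite (rep_Delta_B0m q0 hTV (hT s0)) // (rep_Delta_B0m q0 (hT z0) (hT s0)) //.
have close c u v : u - v = c * (x * Kb q s z - b * Kx q s z) -> u = v.
  by rewrite xb subrr mulr0 => /subr0_eq.
(* Each remaining entry is a multiple of [x * Kb q s z - b * Kx q s z]. *)
pose c := (s * q ^+ 2 * z)^-1.
rewrite /Kmx; omx_compute; omx_entries;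
  [apply: (close c) | apply: (close (- q * c))
  |apply: (close (- q * c)) | apply: (close (- c))];
  by rewrite /Kb /Kx /c /Balpha /Bbeta; field; rewrite ?q0 ?s0 ?z0.
Qed.

(** Brings an unknown matrix, with no structural zeros, into the format on which [omxM] computes. *)
Lemma omx_full n (X : 'M[C]_n) : exists f : nat -> nat -> C,
  X = omx n (mkseq (fun i => mkseq (fun j => Some (f i j)) n) n).
Proof.
case: n X => [|n] X; first by exists (fun _ _ => 0); apply/matrixP=> -[].
exists (fun i j => X (inord i) (inord j)).
by apply/matrixP=> i j; rewrite !mxE !nth_mkseq //= !inord_val.
Qed.

Ltac entry H i j := have := omx_eq H (i := i) (j := j) isT isT;
  omx_lazy.

(** The eigenvalues of [k_2] make [X] block diagonal, [xi_1^+] and [xi_1^-] leave two free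
    parameters, and one entry of the relation for [B0m] fixes their ratio. *)
Lemma intertwines_Kmx X :
  intertwines (coideal_subalgebra (A := A) d) T s z X ->
  exists x b, X = Kmx q x b /\ x * Kb q s z = b * Kx q s z.
Proof.
move=> XP.
have gen b : coideal_gens d b -> lhs b *m X = X *m rhs b.
  by move=> gb; apply: XP; exact: sg_gen.
have := gen _ (cg_k A d ord_max); have := gen _ (cg_xip A d).
have := gen _ (cg_xim A d); have := gen _ (cg_B0m A d) => {gen XP}.
rewrite (rep_Delta_k2 q0 hTV (hT s0)) (rep_Delta_k2 q0 (hT z0) (hT s0)).
rewrite (rep_Delta_xip1 hTV (hT s0)) (rep_Delta_xip1 (hT z0) (hT s0)).
rewrite (rep_Delta_xim1 q0 hTV (hT s0)) (rep_Delta_xim1 q0 (hT z0) (hT s0)).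
rewrite (rep_Delta_B0m q0 hTV (hT s0)) // (rep_Delta_B0m q0 (hT z0) (hT s0)) //.
have [f ->] := omx_full X; rewrite !omxM => BX FX EX kX.
(* An entry of [X] between distinct [k_2]-eigenvalues vanishes; the eigenvalues are [q ^+ 2], [1],
   [1] and [q^-1 ^+ 2]. *)
have kill (a b u : C) : a != b -> a * u = u * b -> u = 0.
  rewrite -subr_eq0 => ab /eqP.
  by rewrite [u * b]mulrC -subr_eq0 -mulrBl mulf_eq0 (negPf ab) => /eqP.
have p2 : 1 != q^-1 ^+ 2.
  by rewrite exprVn eq_sym invr_eq1.
have qp : q ^+ 2 != q^-1 ^+ 2.
  apply: contra q4 => /eqP H; apply/eqP.
  by rewrite (_ : 4 = 2 + 2)%N // exprD {2}H -exprMn divff ?expr1n.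
have f01 : f 0%N 1%N = 0 by entry kX 0%N 1%N; exact: kill.
have f02 : f 0%N 2%N = 0 by entry kX 0%N 2%N; exact: kill.
have f10 : f 1%N 0%N = 0 by entry kX 1%N 0%N; apply: kill; rewrite eq_sym.
have f20 : f 2%N 0%N = 0 by entry kX 2%N 0%N; apply: kill; rewrite eq_sym.
have f03 : f 0%N 3%N = 0 by entry kX 0%N 3%N; exact: kill.
have f30 : f 3%N 0%N = 0 by entry kX 3%N 0%N; apply: kill; rewrite eq_sym.
have f13 : f 1%N 3%N = 0 by entry kX 1%N 3%N; exact: kill.
have f23 : f 2%N 3%N = 0 by entry kX 2%N 3%N; exact: kill.
have f31 : f 3%N 1%N = 0 by entry kX 3%N 1%N; apply: kill; rewrite eq_sym.
have f32 : f 3%N 2%N = 0 by entry kX 3%N 2%N; apply: kill; rewrite eq_sym.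
entry EX 0%N 1%N. entry EX 0%N 2%N. entry EX 1%N 3%N.
entry FX 1%N 0%N. entry BX 0%N 1%N.
rewrite f01 f02 f10 f20 f03 f30 f13 f23 f31 f32.
move=> B01 F10 E13 E02 E01.
set x := f 0%N 0%N in B01 F10 E02 E01 *.
(* The parameter [b] is read off the off-diagonal entry [q * b] of [Kmx]. *)
pose b := f 1%N 2%N / q; have e12 : f 1%N 2%N = q * b by rewrite /b; field.
have e11 : f 1%N 1%N = x - b.
  by rewrite -[x]mul1r F10 /b; ring.
have e21 : f 2%N 1%N = q * b.
  by rewrite -[LHS]mul1r -[LHS](addKr (q * f 1%N 1%N)) E01 e11; ring.
have e22 : f 2%N 2%N = x - q ^+ 2 * b.
  by rewrite -[LHS]mul1r -[LHS](addKr (q * f 1%N 2%N)) E02 e12; ring.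
have e33 : f 3%N 3%N = x - (1 + q ^+ 2) * b.
  by rewrite -[LHS]mul1r E13 e12 e11; ring.
exists x, b; split.
  rewrite e11 e12 e21 e22 e33 /Kmx; apply/matrixP=> i j; rewrite !mxE.
  by ord_cases i; ord_cases j.
(* The factor [s * q ^+ 2 * z] clears the denominators of [Balpha] and [Bbeta]. *)
apply: subr0_eq; rewrite -[RHS](mulr0 (s * q ^+ 2 * z)) -(subrr (x * Bbeta q s z)).
rewrite -{1}B01 e11 e21 /Kb /Kx /Bbeta /Balpha.
by field; rewrite ?q0 ?s0 ?z0.
Qed.

Lemma intertwines_Ksol :
  intertwines (coideal_subalgebra (A := A) d) T s z (Ksol q s z).
Proof.
rewrite /Ksol; case: eqP => z2; apply: Kmx_intertwines; last by rewrite mulrC.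
by rewrite /Kb z2 subrr; ring.
Qed.

Lemma Kmx_neq0 x b : (x, b) != (0, 0) -> Kmx q x b != 0.
Proof.
apply: contra => /eqP K0; have /matrixP := K0 => H.
have := H (@Ordinal 4 0 isT) (@Ordinal 4 0 isT); rewrite !mxE /= => ->.
have := H (@Ordinal 4 1 isT) (@Ordinal 4 2 isT); rewrite !mxE /= => /eqP.
by rewrite mulf_eq0 (negPf q0) => /eqP->.
Qed.

Lemma Kb_neq0 : z ^+ 2 != 1 -> Kb q s z != 0.
Proof. by move=> z2; rewrite !mulf_neq0 // subr_eq0 eq_sym. Qed.

Lemma Ksol_neq0 : Ksol q s z != 0.
Proof.
rewrite /Ksol; case: ifPn => z2; apply: Kmx_neq0; rewrite xpair_eqE negb_and.
  by rewrite oner_eq0.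
by rewrite Kb_neq0 ?orbT.
Qed.

Lemma KmxZ c x b : c *: Kmx q x b = Kmx q (c * x) (c * b).
Proof.
apply/matrixP=> i j; rewrite !mxE.
by ord_cases i; ord_cases j; rewrite /= ?mulr0 //; ring.
Qed.

(** The excluded parameters are the common zeros of [Kb] and [Kx], where the ratio of [x] to [b] is
    undetermined. *)
Lemma intertwines_Ksol_unique X :
  ~ (z ^+ 2 = 1 /\ (s = z * q ^+ 2 \/ s = z / q ^+ 2)) ->
  intertwines (coideal_subalgebra (A := A) d) T s z X ->
  exists c, X = c *: Ksol q s z.
Proof.
move=> nexc /intertwines_Kmx[x [b [-> xb]]]; rewrite /Ksol; case: ifPn => z2.
  exists x; rewrite KmxZ mulr1 mulr0; congr Kmx; apply/eqP.
  move: xb; rewrite {1}/Kb (eqP z2) subrr mulr0 mul0r mulr0 => /esym/eqP.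
  rewrite mulf_eq0 => /orP[//|]; rewrite mulf_eq0 !subr_eq0 => exc.
  case: nexc; split; first exact/eqP.
  case/orP: exc => /eqP exc; [left|right]; first by rewrite mulrC exc.
  (* With [z ^+ 2 = 1], the zero [q ^+ 2 * s * z = 1] of the second factor of [Kx] reads
     [s = z / q ^+ 2]. *)
  have {1}-> : s = z ^+ 2 * s by rewrite (eqP z2) mul1r.
  rewrite -[z in RHS]mulr1 -exc; field; exact: q0.
exists (b / Kb q s z); rewrite KmxZ.
have Kb0 := Kb_neq0 z2.
by rewrite -mulrA [_^-1 * _]mulrC mulrA -xb mulfK // divfK.
Qed.

End Intertwiners.

Theorem proposition4p4 (R : realType) (q : R[i])
    (hq0 : q != 0) (hq : ~ algebraicOver (@ratr R[i]) q)
    (A : Uq_affine_gl11 q)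
    (T : R[i] -> {lrmorphism A -> 'M[R[i]]_2})
    (hT : forall z : R[i], z != 0 -> evaluation_representation z (T z))
    (d : R[i]) (hd : d = (q^-1 - q) / 2%:R) :
  left_coideal (coideal_subalgebra (A := A) d) /\
  forall s : R[i], s != 0 ->
  exists K : R[i] -> 'M[R[i]]_(2 * 2),
    [/\ forall z : R[i], z != 0 ->
          K z != 0 /\ intertwines (coideal_subalgebra (A := A) d) T s z (K z),
        forall z : R[i], z != 0 ->
          ~ (z ^+ 2 = 1 /\ (s = z * q ^+ 2 \/ s = z / q ^+ 2)) ->
          forall X : 'M[R[i]]_(2 * 2),
            intertwines (coideal_subalgebra (A := A) d) T s z X ->
            exists c : R[i], X = c *: K z &
        forall z w : R[i], z != 0 -> w != 0 ->
          R_regular q (z / w) -> R_regular q (z * w) ->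
          reflection_equation q K z w].
Proof.
(* A root of unity is algebraic, being a root of the nonzero polynomial ['X^n - 1]. *)
have q_not_unity_root n : (0 < n)%N -> q ^+ n != 1.
  move=> n0; apply/eqP=> qn; apply: hq; exists ('X^n - 1).
    by rewrite -size_poly_eq0 size_XnsubC.
  by rewrite rmorphB /= rmorph1 map_polyXn rootE !hornerE qn subrr.
have q2 := q_not_unity_root 2 isT; have q4 := q_not_unity_root 4 isT.
split; first exact: coideal_subalgebra_left_coideal.
move=> s s0; exists (Ksol q s); rewrite hd; split.
- by move=> z z0; split; [exact: Ksol_neq0|exact: intertwines_Ksol].
- move=> z z0 nexc X; exact: intertwines_Ksol_unique.
move=> z w z0 w0; exact: reflection_equation_Ksol.
Qed.
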